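(* Let $\mathcal U_1,\mathcal U_2\subset\mathbb R^n$ be connected open sets, let $\gamma: T^*\mathcal U_1\to T^*\mathcal U_2$ be a canonical transformation, let $\Lambda_1\subset T^*\mathcal U_1$ be a Lagrangian submanifold, and put $$\Lambda_2=\gamma(\Lambda_1),\qquad \Gamma=\{(x,y,-\xi,\eta)\ :\ (y,\eta)=\gamma(x,\xi)\}\subset T^*(\mathcal U_1\times\mathcal U_2).$$ Suppose there exist functions $F\in C^\infty(\mathcal U_1)$, $G\in C^\infty(\mathcal U_2)$ and $W\in C^\infty(\mathcal U_1\times\mathcal U_2)$ such that $$(x,\xi)\in\Lambda_1\iff \xi=\frac{\partial F}{\partial x}(x),\qquad (y,\eta)\in\Lambda_2\iff \eta=\frac{\partial G}{\partial y}(y),$$ $$(x,y,\xi,\eta)\in\Gamma\iff \xi=\frac{\partial W}{\partial x}(x,y),\ \ \eta=\frac{\partial W}{\partial y}(x,y).$$ Assume in addition that for every $y\in\mathcal U_2$ the function $x\mapsto F(x)+W(x,y)$ on $\mathcal U_1$ has a unique critical point and that this point is a global minimum. Then there is a constant $C\in\mathbb R$ such that for all $y\in\mathcal U_2$ $$G(y)=\min_{x\in\mathcal U_1}\bigl(F(x)+W(x,y)\bigr)+C .$$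
   Context: Cotangent bundles carry their standard symplectic forms; points of $T^*\mathcal U_1$ are written $(x,\xi)$, points of $T^*\mathcal U_2$ are written $(y,\eta)$, and points of $T^*(\mathcal U_1\times\mathcal U_2)$ are written $(x,y,\xi,\eta)$, where $\xi$ is the covector at $x$ and $\eta$ the covector at $y$. A canonical transformation $\gamma: T^*\mathcal U_1\to T^*\mathcal U_2$ is a diffeomorphism onto an open subset of $T^*\mathcal U_2$ that preserves the symplectic forms. *)

(* Defs.v *)
From HB Require Import structures.
From mathcomp Require Import all_boot all_order all_algebra.
From mathcomp Require Import all_classical all_reals all_analysis.

Set Implicit Arguments.
Unset Strict Implicit.
Unset Printing Implicit Defensive.
Import Order.TTheory GRing.Theory Num.Theory.
Import numFieldNormedType.Exports.

Local Open Scope classical_set_scope.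
Local Open Scope ring_scope.

(* Functions on an open set U are total functions whose values outside U are
   irrelevant: every notion below only uses germs at points of U. For maps
   between finite-dimensional spaces, C^(k+1) is equivalent to being
   differentiable with all directional derivatives of class C^k. *)
Fixpoint Ck (R : realType) (E F : normedModType R) (k : nat) (U : set E)
    (f : E -> F) : Prop :=
  match k with
  | 0 => forall x, U x -> {for x, continuous f}
  | k'.+1 => (forall x, U x -> differentiable f x) /\
             (forall v : E, Ck k' U (fun x => 'D_v f x))
  end.

Definition smooth (R : realType) (E F : normedModType R) (U : set E)
    (f : E -> F) : Prop := forall k, Ck k U f.

Definition diffeo_onto_open (R : realType) (E F : normedModType R) (U : set E)
    (f : E -> F) : Prop :=
  [/\ smooth U f, open (f @` U) &
      exists2 g : F -> E, smooth (f @` U) g & forall x, U x -> g (f x) = x].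

Definition grad (R : realType) (n : nat) (f : 'rV[R]_n -> R) (x : 'rV[R]_n) :
  'rV[R]_n := \row_(i < n) 'D_(delta_mx 0 i) f x.

Definition critical_point (R : realType) (n : nat) (f : 'rV[R]_n -> R)
  (x : 'rV[R]_n) : Prop := grad f x = 0.

(* Covectors are identified with their coordinate rows, so that a covector at
   a point of an open subset of V is again an element of V. *)
Definition cotangent (V : Type) (U : set V) : set (V * V) := U `*` setT.

(* The form \sum_i d xi_i /\ d x_i at any point of T^*R^n, on tangent vectors
   u = (dx, dxi) and v = (dx', dxi'). *)
Definition symp (R : realType) (n : nat) (u v : 'rV[R]_n * 'rV[R]_n) : R :=
  \sum_(i < n) (u.2 0 i * v.1 0 i - u.1 0 i * v.2 0 i).

Definition canonical_transformation (R : realType) (n : nat)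
    (U1 U2 : set 'rV[R]_n)
    (gamma : 'rV[R]_n * 'rV[R]_n -> 'rV[R]_n * 'rV[R]_n) : Prop :=
  [/\ diffeo_onto_open (cotangent U1) gamma,
      gamma @` cotangent U1 `<=` cotangent U2 &
      forall z, cotangent U1 z -> forall u v,
        symp ('d gamma z u) ('d gamma z v) = symp u v].

(* Embedded submanifolds, by slice charts: M has dimension d and
   codimension c. *)
Definition submanifold (R : realType) (E : normedModType R) (d c : nat)
    (M : set E) : Prop :=
  forall p, M p -> exists (O : set E) (phi : E -> 'rV[R]_d * 'rV[R]_c),
    [/\ open O, O p, diffeo_onto_open O phi &
        phi @` (M `&` O) = phi @` O `&` [set q | q.2 = 0]].

(* Tangent vectors of M at p, as velocities of smooth curves in M. *)
Definition tangent (R : realType) (E : normedModType R) (M : set E) (p : E) :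
    set E :=
  [set v | exists (e : R) (c : R -> E),
    [/\ 0 < e, smooth (ball (0 : R) e) c, c 0 = p,
        forall t, ball (0 : R) e t -> M (c t) & 'D_1 c 0 = v]].

Definition lagrangian_submanifold (R : realType) (n : nat) (U : set 'rV[R]_n)
    (L : set ('rV[R]_n * 'rV[R]_n)) : Prop :=
  [/\ L `<=` cotangent U, submanifold n n L &
      forall p, L p -> forall u v, tangent L p u -> tangent L p v ->
        symp u v = 0].

(* A point (x, y, xi, eta) of T^*(U1 x U2) is encoded as ((x, y), (xi, eta)),
   as in cotangent (U1 `*` U2). *)
Definition twisted_graph (R : realType) (n : nat) (U1 : set 'rV[R]_n)
    (gamma : 'rV[R]_n * 'rV[R]_n -> 'rV[R]_n * 'rV[R]_n) :
    set (('rV[R]_n * 'rV[R]_n) * ('rV[R]_n * 'rV[R]_n)) :=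
  [set p | exists x y xi eta,
    [/\ U1 x, (y, eta) = gamma (x, xi) & p = ((x, y), (- xi, eta))]].

Definition is_min (R : realType) (A : set R) (m : R) : Prop :=
  A m /\ lbound A m.

(* Main.v *)
(** Since [gamma] maps [Lambda1] onto [Lambda2], the point [(y, dG y)] is
    [gamma (x, dF x)] for some [x], which depends differentiably on [y] as the
    first component [X y] of [gamma^-1 (y, dG y)]. The twisted graph then gives
    [dF x = - d_x W (x, y)] and [dG y = d_y W (x, y)], so [X y] is the critical
    point, hence the minimizer, of [F + W(., y)]. By the chain rule the minimal
    value [F (X y) + W (X y, y)] has differential [d_y W (X y, y) = dG y], and
    [U2] is connected. *)

Require Import Defs.
From HB Require Import structures.
From mathcomp Require Import all_boot all_order all_algebra.
From mathcomp Require Import all_classical all_reals all_analysis.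

Set Implicit Arguments.
Unset Strict Implicit.
Unset Printing Implicit Defensive.
Import Order.TTheory GRing.Theory Num.Theory.
Import numFieldNormedType.Exports.

Local Open Scope classical_set_scope.
Local Open Scope ring_scope.

Lemma differentiable_fst (R : realType) (V V' : normedModType R) (p : V * V') :
  differentiable fst p.
Proof. by apply: (@linear_differentiable _ _ _ fst) => z; exact: cvg_fst. Qed.

Lemma diff_grad (R : realType) (n : nat) (f : 'rV[R]_n -> R) (x v : 'rV[R]_n) :
  differentiable f x -> 'd f x v = \sum_(i < n) v 0 i * grad f x 0 i.
Proof.
move=> df; rewrite {1}[v]row_sum_delta linear_sum; apply: eq_bigr => i _.
by rewrite linearZ /= mxE deriveE.
Qed.

Lemma differentiable_grad (R : realType) (n : nat) (U : set 'rV[R]_n)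
    (f : 'rV[R]_n -> R) (x : 'rV[R]_n) :
  smooth U f -> U x -> differentiable (grad f) x.
Proof.
move=> /(_ 2)[_ D2f] Ux.
(* Expanding in the fixed basis ['e_i] reduces the claim to the scalar functions
   ['D_(delta_mx 0 i) f], which are differentiable because [f] is of class C^2. *)
have -> : grad f = \sum_(i < n) (fun z => 'D_(delta_mx 0 i) f z *: 'e_i).
  apply/funext => z; rewrite fct_sumE [LHS]row_sum_delta.
  by apply: eq_bigr => i _; rewrite mxE.
apply: differentiable_sum => i; apply: differentiableZl.
by have [+ _] := D2f (delta_mx 0 i); exact.
Qed.

Section PartialDifferentials.
Context (R : realType) (V V' V'' : normedModType R).
Variables (f : V * V' -> V'') (x : V) (y : V').
Hypothesis df : differentiable f (x, y).

Let pairl : is_diff x (fun z : V => (z, y)) (fun z => (z, 0)) :=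
  is_diff_pair (is_diff_id x) (is_diff_cst y x).

Let pairr : is_diff y (fun z : V' => (x, z)) (fun z => (0, z)) :=
  is_diff_pair (is_diff_cst x y) (is_diff_id y).

Lemma differentiable_partiall : differentiable (fun z => f (z, y)) x.
Proof. by apply: (@differentiable_comp _ _ _ _ (fun z => (z, y)) f). Qed.

Lemma differentiable_partialr : differentiable (fun z => f (x, z)) y.
Proof. by apply: (@differentiable_comp _ _ _ _ (fun z => (x, z)) f). Qed.

(** Split [(u, v)] as [(u, 0) + (0, v)] and apply the chain rule along the slices [z |-> (z, y)] and
    [z |-> (x, z)]. *)
Lemma diff_partials u v :
  'd f (x, y) (u, v) = 'd (fun z => f (z, y)) x u + 'd (fun z => f (x, z)) y v.
Proof.
have -> : (u, v) = (u, 0) + (0, v) by congr pair; rewrite /= ?addr0 ?add0r.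
rewrite linearD; congr (_ + _).
- rewrite (@diff_comp _ _ _ _ (fun z => (z, y)) f) //.
  by rewrite /= diff_val.
- rewrite (@diff_comp _ _ _ _ (fun z => (x, z)) f) //.
  by rewrite /= diff_val.
Qed.

End PartialDifferentials.

(** The mean value theorem on [[0, 1]] applies to [t |-> f (a + t *: v)], whose derivative vanishes
    by the chain rule. *)
Lemma diff0_segment (R : realType) (V : normedModType R) (f : V -> R)
    (a v : V) :
  (forall t : R, t \in `[0, 1] ->
    is_diff (a + t *: v) f (0 : V -> R)) ->
  f (a + v) = f a.
Proof.
move=> df; pose l (t : R) := a + t *: v.
have dl (t : R) : differentiable l t.
  by have [] := is_diffD (is_diff_cst a t) (is_diff_scalel t v).
have dfl (t : R) : t \in `[0, 1] -> is_derive t 1 (f \o l) 0.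
  move=> /df [dft f0]; have dflt := differentiable_comp (dl t) dft.
  by split; [exact: diff_derivable|rewrite deriveE // diff_comp //= f0].
have dfl_oo (t : R) : t \in `]0, 1[ -> is_derive t 1 (f \o l) 0.
  by move=> t01; apply: dfl; apply: subset_itv_oo_cc.
have cfl : {within `[0, 1], continuous (f \o l)}.
  by apply: derivable_within_continuous => t /dfl[].
have [c _] := @MVT_segment R (f \o l) (fun=> 0) 0 1 ler01 dfl_oo cfl.
by rewrite /= /l scale1r scale0r addr0 mul0r => /eqP; rewrite subr_eq0 => /eqP.
Qed.

(** Balls are star-shaped about their centre, so [f] is locally constant; its fibers are then open
    and closed in [U]. *)
Lemma diff0_connected_cst (R : realType) (V : normedModType R) (U : set V)
    (f : V -> R) :
  open U -> connected U -> (forall x, U x -> is_diff x f (0 : V -> R)) ->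
  exists c, forall x, U x -> f x = c.
Proof.
move=> oU cU df.
have [[x0 Ux0]|/forallNP U0] := pselect (exists x, U x); last first.
  by exists 0 => x /U0.
exists (f x0).
have near_cst x : U x -> \forall z \near x, U z /\ f z = f x.
  move=> Ux; have /nbhs_ballP[e /= e0 xeU] := open_nbhs_nbhs (conj oU Ux).
  near=> z; have xez : ball x e z by near: z; exact: nbhsx_ballx.
  split; first exact: xeU.
  (* With [z = x + (z - x)], each point [x + t *: (z - x)] of the segment lies at distance at most
     [|z - x|] from [x], hence in the ball. *)
  rewrite -[z](subrK x) addrC; apply: diff0_segment => t /itvP t01.
  apply/df/xeU; move: xez; rewrite -!ball_normE /= opprD addNKr normrN normrZ.
  rewrite distrC; apply: le_lt_trans; rewrite ger0_norm ?t01 //.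
  by rewrite ler_piMl // t01.
(* An arbitrary [P] covers both the fiber over [f x0] and its complement in [U]. *)
have open_fiber (P : set R) : open [set x | U x /\ P (f x)].
  rewrite openE => x [Ux Px]; apply: filterS (near_cst _ Ux) => z [Uz fz].
  by split; rewrite ?fz.
have <- : [set x | U x /\ f x = f x0] = U.
  apply: cU; first by exists x0.
  - exists [set x | U x /\ f x = f x0]; first exact: (open_fiber [set f x0]).
    by apply/seteqP; split=> x /=; tauto.
  - exists (~` [set x | U x /\ f x <> f x0]).
      by apply: open_closedC; exact: (open_fiber (~` [set f x0])).
    apply/seteqP; split=> x /=; first by move=> [Ux ->]; split=> // -[].
    by move=> [Ux /not_andP[//|/contrapT]].
by move=> x [].
Unshelve. all: by end_near. Qed.

Theorem theorem3p1 (R : realType) (n : nat) (U1 U2 : set 'rV[R]_n)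
    (gamma : 'rV[R]_n * 'rV[R]_n -> 'rV[R]_n * 'rV[R]_n)
    (Lambda1 Lambda2 : set ('rV[R]_n * 'rV[R]_n))
    (Gamma : set (('rV[R]_n * 'rV[R]_n) * ('rV[R]_n * 'rV[R]_n)))
    (F G : 'rV[R]_n -> R) (W : 'rV[R]_n * 'rV[R]_n -> R)
    (U1_open : open U1) (U1_connected : connected U1)
    (U2_open : open U2) (U2_connected : connected U2)
    (gamma_canonical : canonical_transformation U1 U2 gamma)
    (Lambda1_lagrangian : lagrangian_submanifold U1 Lambda1)
    (Lambda2_def : Lambda2 = gamma @` Lambda1)
    (Gamma_def : Gamma = twisted_graph U1 gamma)
    (F_smooth : smooth U1 F) (G_smooth : smooth U2 G)
    (W_smooth : smooth (U1 `*` U2) W)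
    (Lambda1_F : forall x xi, U1 x -> (Lambda1 (x, xi) <-> xi = grad F x))
    (Lambda2_G : forall y eta, U2 y -> (Lambda2 (y, eta) <-> eta = grad G y))
    (Gamma_W : forall x y xi eta, U1 x -> U2 y ->
      (Gamma ((x, y), (xi, eta)) <->
        xi = grad (fun x' => W (x', y)) x /\
        eta = grad (fun y' => W (x, y')) y))
    (unique_critical_min : forall y, U2 y ->
      exists x0, [/\ U1 x0,
        critical_point (fun x => F x + W (x, y)) x0,
        (forall x, U1 x -> critical_point (fun x' => F x' + W (x', y)) x ->
          x = x0) &
        (forall x, U1 x -> F x0 + W (x0, y) <= F x + W (x, y))]) :
  exists C : R, forall y, U2 y ->
    exists2 m : R, is_min [set F x + W (x, y) | x in U1] m & G y = m + C.
Proof.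
case: gamma_canonical => -[_ _ [g g_smooth gK]] _ _.
case: Lambda1_lagrangian => Lambda1_sub _ _.
have dF x : U1 x -> differentiable F x by have [+ _] := F_smooth 1; exact.
have dG y : U2 y -> differentiable G y by have [+ _] := G_smooth 1; exact.
have dW x y : U1 x -> U2 y -> differentiable W (x, y).
  by move=> ? ?; have [+ _] := W_smooth 1; apply.
pose X y := (g (y, grad G y)).1.
have X_spec y : U2 y -> [/\ differentiable X y, U1 (X y),
    grad F (X y) = - grad (fun x => W (x, y)) (X y) &
    grad G y = grad (fun y' => W (X y, y')) y].
  move=> U2y; have := (Lambda2_G y _ U2y).2 erefl.
  rewrite Lambda2_def => -[[x xi] L1 gxE].
  have [/= U1x _] := Lambda1_sub _ L1.
  have gE : g (y, grad G y) = (x, xi) by rewrite -gxE gK.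
  have XE : X y = x by rewrite /X gE.
  have xiE : xi = grad F x by apply/Lambda1_F.
  have : Gamma ((x, y), (- xi, grad G y)).
    by rewrite Gamma_def; exists x, y, xi, (grad G y); split.
  move=> /(Gamma_W _ _ _ _ U1x U2y) [xiW GW].
  (* The sign in the twisted graph gives [- xi = d_x W], while [xi = dF]; only the differentiability
     of [X] remains. *)
  rewrite XE -xiE -xiW opprK; split=> //.
  apply: (@differentiable_comp _ _ _ _ (fun y => g (y, grad G y)) fst).
    apply: (@differentiable_comp _ _ _ _ (fun y => (y, grad G y)) g).
      by apply: differentiable_pair => //; apply: differentiable_grad U2y.
    (* [g] is smooth only on the image of [gamma], so [(y, grad G y)] is exhibited as the image of
       [(x, xi)]. *)
    have [+ _] := g_smooth 1; apply; exists (x, xi) => //.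
  exact: differentiable_fst.
have X_min y : U2 y -> forall x, U1 x ->
    F (X y) + W (X y, y) <= F x + W (x, y).
  move=> U2y; have [x0 [U1x0 _ x0_uniq x0_min]] := unique_critical_min y U2y.
  have [_ U1X FW _] := X_spec y U2y.
  (* Uniqueness of the critical point transfers minimality from [x0] to [X y], once [X y] is shown
     to be critical. *)
  suff -> : X y = x0 by [].
  apply: x0_uniq => //; apply/rowP => i.
  have dWx := differentiable_partiall (dW _ _ U1X U2y).
  rewrite mxE deriveD; [|exact/diff_derivable/dF|exact: diff_derivable].
  by move/rowP: FW => /(_ i); rewrite !mxE => ->; rewrite addNr.
have [C GC] : exists C, forall y, U2 y -> G y - (F (X y) + W (X y, y)) = C.
  apply: (@diff0_connected_cst _ _ U2 (fun y => G y - (F (X y) + W (X y, y))))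
    => // y U2y.
  have [dX U1X FW GW] := X_spec y U2y.
  have dGy := differentiableP (dG y U2y).
  have dFX := is_diff_comp (differentiableP dX) (differentiableP (dF _ U1X)).
  have dWX := is_diff_comp
    (is_diff_pair (differentiableP dX) (is_diff_id y))
    (differentiableP (dW _ _ U1X U2y)).
  apply: is_diff_eq (is_diffB dGy (is_diffD dFX dWX)) _.
  apply/funext => v.
  have dWXy := dW _ _ U1X U2y.
  (* Criticality of [X y], tested on the displacement ['d X y v]: the variation of the minimizer
     does not contribute to the first-order variation of the minimum. *)
  have FWx : 'd F (X y) ('d X y v) =
      - 'd (fun x => W (x, y)) (X y) ('d X y v).
    apply: etrans (diff_grad _ (dF _ U1X)) _; rewrite FW.
    transitivity (- \sum_(i < n)
        'd X y v 0 i * grad (fun x => W (x, y)) (X y) 0 i).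
      by rewrite -sumrN; apply: eq_bigr => i _; rewrite [in LHS]mxE mulrN.
    by congr -%R; apply/esym/diff_grad; exact: differentiable_partiall.
  have GWy : 'd G y v = 'd (fun y' => W (X y, y')) y v.
    apply: etrans (diff_grad _ (dG _ U2y)) _; rewrite GW.
    by apply/esym; exact: diff_grad (differentiable_partialr dWXy).
  (* Here [a] is the variation of [F], [c] that of [G], and [w] the full variation of [W], with
     partial contributions [b] in [x] and [d] in [y]. *)
  have sum0 (a b c d w : R) :
      a = - b -> c = d -> w = b + d -> c - (a + w) = 0.
    by move=> -> -> ->; rewrite addKr subrr.
  exact: sum0 FWx GWy (diff_partials dWXy _ _).
exists C => y U2y; exists (F (X y) + W (X y, y)).
  by have [_ U1X _ _] := X_spec y U2y; split; [exists (X y)|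
    move=> _ [x U1x <-]; exact: X_min].
by rewrite -(GC y U2y) addrC subrK.
Qed.
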